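(* There exists an absolute constant $C>0$ such that for every integer $n \geq 1$ and all integers $a,b,c$ with $1 \leq a,b,c \leq n$: if $\sqrt{a}+\sqrt{b}+\sqrt{c}$ is not an integer, then $$ \left\| \sqrt{a}+\sqrt{b}+\sqrt{c} \right\| \geq \frac{C}{n^{7/2}}.$$
   Context: For a real number $x$, $\|x\| = \min_{m \in \mathbb{Z}} |x-m|$ denotes the distance from $x$ to the nearest integer. *)

(* Defs.v *)
From mathcomp Require Import all_boot all_order all_algebra archimedean.
From mathcomp Require Import boolp classical_sets reals exp.

Set Implicit Arguments.
Unset Strict Implicit.
Unset Printing Implicit Defensive.

Import Order.TTheory GRing.Theory Num.Theory.
Local Open Scope classical_set_scope.
Local Open Scope ring_scope.

(* The infimum is attained (dist_int_attained), hence is a minimum. *)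
Definition dist_int (R : realType) (x : R) : R :=
  inf [set `|x - m%:~R| | m in [set: int]].

Lemma dist_int_le (R : realType) (x : R) (m : int) :
  dist_int x <= `|x - m%:~R|.
Proof.
apply: ge_inf; last by exists m.
by exists 0 => _ [k _ <-].
Qed.

Lemma dist_int_attained (R : realType) (x : R) :
  exists m : int, dist_int x = `|x - m%:~R|.
Proof.
pose f := Num.floor x.
have /andP[fx xf] : f%:~R <= x < (f + 1)%:~R by exact: floor_itv.
pose m := if `|x - f%:~R| <= `|x - (f + 1)%:~R| then f else f + 1.
exists m; apply/eqP; rewrite eq_le dist_int_le /=.
apply: lb_le_inf; first by exists `|x - 0%:~R|, 0.
move=> _ [k _ <-].
have mf : `|x - m%:~R| <= `|x - f%:~R|.
  by rewrite /m; case: ifP => // /negbT; rewrite -ltNge => /ltW.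
have mf1 : `|x - m%:~R| <= `|x - (f + 1)%:~R| by rewrite /m; case: ifP.
have [kf|fk] := leP k f.
  apply: le_trans mf _.
  have kfR : k%:~R <= f%:~R :> R by rewrite ler_int.
  by rewrite !ger0_norm ?subr_ge0 ?lerB ?(le_trans kfR).
apply: le_trans mf1 _.
have fkR : (f + 1)%:~R <= k%:~R :> R by rewrite ler_int lezD1.
have xk := ltW (lt_le_trans xf fkR).
by rewrite !ler0_norm ?subr_le0 ?(ltW xf) // lerN2 lerB.
Qed.

(* Main.v *)
(* For an integer m, the product of the eight numbers m +- sqrt a +- sqrt b +- sqrt c
   is an integer.  If d = m - (sqrt a + sqrt b + sqrt c) satisfies |d| < 1, then each
   factor other than d is d plus twice a nonempty sum of square roots, hence lies
   between 1 and 7 sqrt n; if d <> 0 the product is a nonzero integer, which gives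
   1 <= |d| (7 sqrt n)^7. *)
Require Import Defs.
From mathcomp Require Import all_boot all_order all_algebra archimedean.
From mathcomp Require Import boolp classical_sets reals exp.
From mathcomp Require Import ring lra.

Set Implicit Arguments.
Unset Strict Implicit.
Unset Printing Implicit Defensive.

Import Order.TTheory GRing.Theory Num.Theory.
Local Open Scope ring_scope.

Lemma prodr_gt0_le_exp (R : numDomainType) (k : R) (l : seq R) :
  all (fun y => 0 < y <= k) l -> 0 < \prod_(y <- l) y <= k ^+ size l.
Proof.
elim: l => [_|y l IHl] /=; first by rewrite big_nil expr0 ltr01 lexx.
case/andP=> /andP[y0 yk] /IHl/andP[l0 lk].
by rewrite big_cons mulr_gt0 //= exprS ler_pM // ltW.
Qed.

(* The factors x +- p +- q +- r other than x - (p + q + r), written in terms of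
   d = x - (p + q + r). *)
Definition other_conjugates (R : pzRingType) (p q r d : R) : seq R :=
  [:: d + 2 * p; d + 2 * q; d + 2 * r; d + 2 * (p + q); d + 2 * (p + r);
      d + 2 * (q + r); d + 2 * (p + q + r)].

Lemma norm_form_int (R : archiNumDomainType) (p q r d : R) :
  p ^+ 2 \is a Num.int -> q ^+ 2 \is a Num.int -> r ^+ 2 \is a Num.int ->
  d + (p + q + r) \is a Num.int ->
  d * \prod_(y <- other_conjugates p q r d) y \is a Num.int.
Proof.
move=> pZ qZ rZ; set x := d + _ => xZ.
(* Multiplying over the signs of q and r gives A + B v or A - B v,
   where v = 2 x p is the only irrational quantity. *)
pose u := x ^+ 2 + p ^+ 2.
pose A := u ^+ 2 + 4 * x ^+ 2 * p ^+ 2 - 2 * (q ^+ 2 + r ^+ 2) * u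
          + (q ^+ 2 - r ^+ 2) ^+ 2.
pose B := 2 * u - 2 * (q ^+ 2 + r ^+ 2).
have -> : d * \prod_(y <- other_conjugates p q r d) y =
          A ^+ 2 - 4 * x ^+ 2 * p ^+ 2 * B ^+ 2.
  by rewrite /other_conjugates !big_cons big_nil /A /B /u /x; ring.
(* Only even powers of [p], [q], [r] survive, so this is an integer polynomial in the integers [x],
   [p ^+ 2], [q ^+ 2], [r ^+ 2]. *)
by do ?[exact: rpred_nat | assumption | apply: rpredB | apply: rpredD
       | apply: rpredM | apply: rpredX].
Qed.

Lemma powR_half_exp (R : realType) (x : R) (k : nat) :
  0 <= x -> x `^ (k%:R / 2) = Num.sqrt x ^+ k.
Proof.
by move=> x0; rewrite mulrC powRrM powR12_sqrt // powR_mulrn // sqrtr_ge0.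
Qed.

Theorem proposition1 (R : realType) :
  exists2 C : R, 0 < C &
    forall n : nat, (1 <= n)%N ->
    forall a b c : nat,
      (1 <= a <= n)%N -> (1 <= b <= n)%N -> (1 <= c <= n)%N ->
      let s : R := Num.sqrt a%:R + Num.sqrt b%:R + Num.sqrt c%:R in
      s \isn't a Num.int ->
      C / n%:R `^ (7 / 2) <= dist_int s.
Proof.
(* One factor 7 for each of the seven other conjugates. *)
exists (7 ^+ 7)^-1; first by rewrite invr_gt0 exprn_gt0.
move=> n n1 a b c ha hb hc s sNZ.
have [m ->] := dist_int_attained s.
rewrite powR_half_exp // -invfM -exprMn.
set w := Num.sqrt n%:R.
have w1 : 1 <= w by rewrite -[1]sqrtr1 ler_sqrt ?ler1n.
have sqrt_bounds k : (1 <= k <= n)%N -> 1 <= Num.sqrt (k%:R : R) <= w.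
  by case/andP=> k1 kn; rewrite -{1}[1]sqrtr1 !ler_sqrt ?ler0n // ler1n ler_nat k1.
have sqrt_sqZ k : Num.sqrt (k%:R : R) ^+ 2 \is a Num.int.
  by rewrite sqr_sqrtr // rpred_nat.
rewrite distrC; set d := m%:~R - s.
have d0 : d != 0.
  by apply: contra sNZ; rewrite subr_eq0 => /eqP <-; exact: intr_int.
have w70 : 0 < (7 * w) ^+ 7 by rewrite exprn_gt0 //; lra.
rewrite -div1r ler_pdivrMr //.
(* For [|d| >= 1] the bound is immediate because [7 * w >= 1]; the conjugates are needed only for
   [|d| < 1]. *)
have [d1|d1] := leP 1 `|d|.
  by rewrite -[1]mulr1 ler_pM // exprn_ege1 //; lra.
have dsZ : d + s \is a Num.int by rewrite subrK intr_int.
have := norm_form_int (sqrt_sqZ a) (sqrt_sqZ b) (sqrt_sqZ c) dsZ.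
set l := other_conjugates _ _ _ _ => PZ.
have /andP[P0 Ple] : 0 < \prod_(y <- l) y <= (7 * w) ^+ 7.
  apply: (@prodr_gt0_le_exp _ _ l).
  (* Each factor adds to [d], which lies in (-1, 1), twice a sum of one to three roots in [1, w]: it
     exceeds 2 - 1 and is below 1 + 6 w, at most 7 w. *)
  move: d1 (sqrt_bounds _ ha) (sqrt_bounds _ hb) (sqrt_bounds _ hc).
  rewrite ltr_norml => /andP[? ?] /andP[? ?] /andP[? ?] /andP[? ?].
  by rewrite /l /=; do !(apply/andP; split) => //; lra.
have := norm_intr_ge1 PZ; move/(_ (mulf_neq0 d0 (lt0r_neq0 P0)))/le_trans.
by apply; rewrite normrM (gtr0_norm P0) ler_wpM2l.
Qed.
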